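(* (Maximum principle.) Let $G=(V,E)$ be a finite connected weighted graph, let $T>0$, and let $k:V\times[0,T]\to\mathbb{R}$ be bounded. Suppose $v\in C^1(V\times[0,T])$ satisfies $$v_t(x,t)-\Delta_V v(x,t)-k(x,t)v(x,t)\ge 0\ \text{ for }(x,t)\in V\times(0,T],\qquad v(x,0)\ge 0\ \text{ for }x\in V.$$ Then $v(x,t)\ge 0$ on $V\times[0,T]$.
   Context: $G=(V,E)$ is a finite, undirected, connected graph with a weight $\omega:V\times V\to[0,\infty)$, $\omega_{xy}=\omega_{yx}$, $\omega_{xy}=0$ if and only if $xy\notin E$, and a measure $\mu:V\to(0,\infty)$. The graph Laplacian is $\Delta_V u(x)=\sum_{y\in V}(u(y)-u(x))\frac{\omega_{yx}}{\mu(x)}$ (acting in $x$). For an interval $I$, $v\in C^1(V\times I)$ means that $v(x,\cdot)$ is continuously differentiable on $I$ for each $x\in V$ (one-sided at included endpoints). *)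

(* Defs.v *)
From mathcomp Require Import all_boot all_order all_algebra.
From mathcomp Require Import all_classical all_reals all_analysis.
Import Order.TTheory GRing.Theory Num.Theory.
Import numFieldNormedType.Exports.

Set Implicit Arguments.
Unset Strict Implicit.
Unset Printing Implicit Defensive.

Local Open Scope classical_set_scope.
Local Open Scope ring_scope.

(* Loops are not excluded; they do not contribute to the Laplacian. *)
Record weightedGraph (R : realType) := WeightedGraph {
  vertex :> finType;
  edge : rel vertex;
  weight : vertex -> vertex -> R;
  vmeasure : vertex -> R;
  edge_sym : symmetric edge;
  weight_ge0 : forall x y, 0 <= weight x y;
  weight_sym : forall x y, weight x y = weight y x;
  weight_eq0 : forall x y, weight x y = 0 <-> ~~ edge x y;
  vmeasure_gt0 : forall x, 0 < vmeasure x }.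

Definition connected_graph (R : realType) (G : weightedGraph R) : Prop :=
  forall x y : G, connect (@edge R G) x y.

Definition laplacian (R : realType) (G : weightedGraph R) (u : G -> R) (x : G)
    : R :=
  \sum_(y : G) (u y - u x) * (weight y x / vmeasure x).

(* The difference quotient at t is only taken over points s of D, s != t, so
   that on an interval D the derivative at an included endpoint is the
   one-sided one and the values of f outside D are irrelevant. *)
Definition derivable_on (R : realType) (D : set R) (f : R -> R) (t : R) : Prop :=
  cvg ((f s - f t) / (s - t) @[s --> within D t^']).

Definition derive_on (R : realType) (D : set R) (f : R -> R) (t : R) : R :=
  lim ((f s - f t) / (s - t) @[s --> within D t^']).

Definition C1_on (R : realType) (D : set R) (f : R -> R) : Prop :=
  (forall t, D t -> derivable_on D f t) /\
  {within D, continuous (derive_on D f)}.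

(* Main.v *)
Require Import Defs.
From mathcomp Require Import all_boot all_order all_algebra.
From mathcomp Require Import all_classical all_reals all_analysis.
From mathcomp Require Import lra.
Import Order.TTheory GRing.Theory Num.Theory.
Import numFieldNormedType.Exports.

Local Open Scope classical_set_scope.
Local Open Scope ring_scope.

(** If [v] were negative somewhere, damp it: put
    [w x t = v x t * exp (- c t)] with [c] large compared with a bound [K] of
    [k].  The damping keeps the sign, and [w], being continuous on the compact
    [G * [0, T]], attains its minimum at some [(x, t)]
    ([finite_family_min]).  That minimum is negative, so [t > 0].
    - Minimality in space gives [v x t <= v y t] for all [y], so the Laplacian
      of [v] is nonnegative at [(x, t)] ([laplacian_ge0]), and the differential
      inequality yields [v_t >= k v >= K v] there, as [v x t < 0].
    - Minimality in time makes [v] decrease towards [v x t] from the left at a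
      rate governed by [c] ([quotient_le]), so [v_t <= (K + 1) v].
    As [v x t < 0], these two estimates are incompatible.

    The upper estimate of [v_t] is read off the left difference quotients of
    [v] itself, with [exp y >= 1 + y] as the only quantitative property of the
    exponential, so that no product rule for [derive_on] is involved. *)

(** The difference quotient times [s - t] tends to [0]. *)
Lemma derivable_on_continuous {R : realType} {D : set R} {f : R -> R} :
  (forall t, D t -> derivable_on D f t) -> {within D, continuous f}.
Proof.
move=> df; apply/subspace_continuousP => t Dt.
pose q s := (f s - f t) / (s - t).
have q_cvg : q s @[s --> within D t^'] --> derive_on D f t := df t Dt.
have qM_cvg : q s * (s - t) @[s --> within D t^'] --> (0 : R).
  rewrite -(mulr0 (derive_on D f t)); apply: cvgM => //.
  rewrite -[X in _ --> X](subrr t); apply: cvgB; last exact: cvg_cst.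
  apply: cvg_trans (@cvg_id _ (nbhs t)) => A nA.
  by apply: filterS (nbhs_dnbhs nA) => s As _.
apply/cvgrPdist_lt => e e0.
have qM_lt : \forall s \near t, s != t -> D s -> `|0 - q s * (s - t)| < e.
  by move/cvgrPdist_lt: qM_cvg; exact.
suff : \forall s \near t, D s -> `|f t - f s| < e by [].
apply: filterS qM_lt => s qs Ds.
have [->|st] := eqVneq s t; first by rewrite subrr normr0.
by have := qs st Ds; rewrite sub0r /q divfK ?subr_eq0// normrN distrC.
Qed.

(** Only the left quotients are bounded, but where [D] is a left neighbourhood
    of [t] the filter [t^'-] refines the one defining [derive_on], hence computes
    the same limit. *)
Lemma derive_on_le_left {R : realType} {D : set R} {f : R -> R} {t a : R} :
  derivable_on D f t -> (\forall s \near t^'-, D s) ->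
  (\forall s \near t^'-, (f s - f t) / (s - t) <= a) -> derive_on D f t <= a.
Proof.
move=> df Dleft qle.
have q_cvg : (f s - f t) / (s - t) @[s --> t^'-] --> derive_on D f t.
  apply: cvg_trans df; apply: cvg_app => A.
  move=> nA.
  have {}nA : \forall s \near t, s != t -> D s -> A s by exact: nA.
  have {}Dleft : \forall s \near t, s < t -> D s by exact: Dleft.
  suff : \forall s \near t, s < t -> A s by [].
  near=> s => st; have tDA : s != t -> D s -> A s by near: s.
  have tD : s < t -> D s by near: s.
  by apply: tDA (tD st); rewrite lt_eqF.
by rewrite -(cvg_lim _ q_cvg)//; apply: limr_le => //; apply: cvgP q_cvg.
Unshelve. all: by end_near. Qed.

(** The tangent [1 - y] at [0] lies below [exp (- y)]; halving its slope gives
    an upper bound near [0], because [exp (- y) <= 1 / (1 + y)] and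
    [1 <= (1 + y) * (1 - y / 2)] for [y] between [0] and [1]. *)
Lemma expRN_le (R : realType) (y : R) :
  0 <= y <= 1 -> expR (- y) <= 1 - y / 2.
Proof.
move=> /andP[y0 y1]; rewrite expRN.
have := expR_ge1Dx y => Ey.
have Epos : 0 < expR y := expR_gt0 y.
rewrite -[X in X <= _]mul1r ler_pdivrMr//; nra.
Qed.

(** With [a = f t] and [b = f s], this turns minimality at [t] of the damped
    function [f r * exp (- c r)] into a bound on the left difference quotients
    of [f].  The factor [1 / 2] makes the bound uniform for [t - s <= 1 / c],
    instead of asymptotic as [s] tends to [t]. *)
Lemma quotient_le (R : realType) (c s t a b : R) :
  s < t -> 0 <= c -> c * (t - s) <= 1 -> a <= 0 ->
  a * expR (- (c * t)) <= b * expR (- (c * s)) ->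
  (b - a) / (s - t) <= c / 2 * a.
Proof.
move=> st c0 ct a0 ab.
have st0 : s - t < 0 by rewrite subr_lt0.
have {}ab : a * expR (- (c * (t - s))) <= b.
  rewrite -(ler_pM2r (expR_gt0 (- (c * s)))); apply: le_trans ab.
  by rewrite -mulrA -expRD -opprD -mulrDr subrK.
have /expRN_le E : 0 <= c * (t - s) <= 1.
  by rewrite ct mulr_ge0// subr_ge0 ltW.
rewrite ler_ndivrMr//.
apply: (@le_trans _ _ (a * expR (- (c * (t - s))) - a)); last by rewrite lerB.
have := ler_wnM2l a0 E; lra.
Qed.

Lemma laplacian_ge0 (R : realType) (G : weightedGraph R) (u : G -> R) (x : G) :
  (forall y, u x <= u y) -> 0 <= laplacian u x.
Proof.
move=> umin; apply: sumr_ge0 => y _.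
by rewrite mulr_ge0 ?subr_ge0// divr_ge0 ?weight_ge0// ltW ?vmeasure_gt0.
Qed.

Lemma finite_family_min {R : realType} {I : finType} (i0 : I) {a b : R}
    {w : I -> R -> R} :
  a <= b -> (forall i, {within `[a, b], continuous (w i)}) ->
  exists i : I, exists2 t : R, t \in `[a, b] &
    forall j s, s \in `[a, b] -> w i t <= w j s.
Proof.
move=> ab wc.
have /choice[m mP] i : exists t, t \in `[a, b] /\
    forall s, s \in `[a, b] -> w i t <= w i s.
  by have [t tab tmin] := EVT_min ab (wc i); exists t.
have [i _ imin] :=
  @Order.TotalTheory.arg_minP _ _ I i0 xpredT (fun i => w i (m i)) isT.
exists i, (m i); first by have [] := mP i.
move=> j s sab; apply: le_trans (imin j isT) _.
by have [_] := mP j; apply.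
Qed.

Theorem theorem3p6 (R : realType) (G : weightedGraph R) (T : R)
    (k v : G -> R -> R) :
  connected_graph G ->
  0 < T ->
  [bounded k p.1 p.2 | p in [set: G] `*` `[0, T]] ->
  (forall x : G, C1_on `[0, T] (v x)) ->
  (forall (x : G) (t : R), t \in `]0, T] ->
     derive_on `[0, T] (v x) t - laplacian (v^~ t) x - k x t * v x t >= 0) ->
  (forall x : G, v x 0 >= 0) ->
  forall (x : G) (t : R), t \in `[0, T] -> v x t >= 0.
Proof.
move=> _ T0 /pinfty_ex_gt0[K K0 kK] vC1 vP v0 x1 t1 t1T.
have {}kK x t : t \in `[0, T] -> `|k x t| <= K.
  by move=> tT; apply: (kK (x, t)).
(* The estimate of v_t carries c / 2, which has to exceed K. *)
pose c := 2 * (K + 1).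
have c_gt0 : 0 < c by rewrite mulr_gt0// addr_gt0.
pose w x t := v x t * expR (- (c * t)).
have wc x : {within `[0, T], continuous (w x)}.
  have vc := derivable_on_continuous (vC1 x).1.
  move=> t; apply: cvgM; first exact: vc.
  have: continuous (fun t : R => expR (- (c * t))).
    move=> s; apply: continuous_comp; last exact: continuous_expR.
    by apply: cvgN; apply: cvgM; [exact: cvg_cst|exact: cvg_id].
  by move/continuous_subspaceT; exact.
have [x [t tT wmin]] := finite_family_min x1 (ltW T0) wc.
have sgn_w y s : (0 <= w y s) = (0 <= v y s) by rewrite pmulr_lge0 ?expR_gt0.
rewrite -sgn_w; apply: le_trans (wmin x1 t1 t1T); rewrite sgn_w leNgt.
apply/negP => vneg.
have t_gt0 : 0 < t.
  rewrite lt_neqAle; move: tT; rewrite in_itv/= => /andP[-> _]; rewrite andbT.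
  by apply: contraTneq vneg => <-; rewrite -leNgt.
have t_le : t <= T by move: tT; rewrite in_itv/= => /andP[].
have lap0 : 0 <= laplacian (v^~ t) x.
  apply: laplacian_ge0 => y.
  by rewrite -(ler_pM2r (expR_gt0 (- (c * t)))); exact: wmin.
have dv_le : derive_on `[0, T] (v x) t <= c / 2 * v x t.
  have left_in : \forall s \near t^'-, [set` `[0, T]] s.
    near=> s; rewrite /= in_itv/=; apply/andP; split.
      by near: s; exact: nbhs_left_ge.
    by apply: le_trans t_le; near: s; exact: nbhs_left_le.
  apply: (derive_on_le_left ((vC1 x).1 t tT) left_in).
  near=> s; apply: quotient_le; rewrite ?(ltW c_gt0) ?(ltW vneg)//.
  (* s is taken within 1 / c of t. *)
  - rewrite mulrC -ler_pdivlMr// lerBlDr -lerBlDl; near: s.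
    by apply: nbhs_left_ge; rewrite ltrBlDr ltrDl divr_gt0.
  - by apply: wmin; near: s.
have := vP x t; rewrite in_itv/= t_gt0 t_le => /(_ isT).
have kle : k x t <= K.
  by apply: le_trans (ler_norm _) _; exact: kK.
have : K * v x t <= k x t * v x t by rewrite ler_wnM2r// ltW.
have c2 : c / 2 = K + 1 by rewrite /c mulrAC divff// mul1r.
by move: dv_le lap0; rewrite c2; lra.
Unshelve. all: by end_near. Qed.
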